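(* Let $G(m_1,m_2,m_3)$ denote the three-dimensional Geode numbers, defined as in the context. There exist rational functions $f_1(n)$ and $f_2(n)$ in $n$, whose numerators and denominators are polynomials of degree $35$ in $n$, such that the diagonal sequence $\{G(n,n,n)\}_{n\ge1}$ satisfies the second-order linear recurrence $$G(n,n,n)=f_1(n)\,G(n-1,n-1,n-1)+f_2(n)\,G(n-2,n-2,n-2)$$ for all integers $n\ge 3$ at which $f_1$ and $f_2$ are defined. The initial values are $G(1,1,1)=319$ and $G(2,2,2)=669123$.
   Context: For nonnegative integers $m_1,\dots,m_k$, the hyper-Catalan number is $$C(m_1,\dots,m_k)=\frac{(2m_1+3m_2+\cdots+(k+1)m_k)!}{(1+m_1+2m_2+\cdots+km_k)!\,m_1!\cdots m_k!}.$$ For positive integers $n,k$, define $$P_{n,k}(t_1,\dots,t_k)=\sum_{m_1+\cdots+m_k=n} C(m_1,\dots,m_k)\,t_1^{m_1}\cdots t_k^{m_k}.$$ This polynomial is divisible by $t_1+\cdots+t_k$, a fact due to Rubine and Wildberger. The Geode polynomial is $$Q_{n,k}(t_1,\dots,t_k)=\frac{P_{n+1,k}(t_1,\dots,t_k)}{t_1+\cdots+t_k}.$$ For nonnegative integers $m_1,\dots,m_k$, the Geode number $G(m_1,\dots,m_k)$ is the coefficient of $t_1^{m_1}\cdots t_k^{m_k}$ in $Q_{m_1+\cdots+m_k,k}(t_1,\dots,t_k)$. Here $k=3$. *)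

(* Defs.v *)
From HB Require Import structures.
From mathcomp Require Import all_boot all_order all_algebra.
From mathcomp Require Import ring zify.
From mathcomp.multinomials Require Import mpoly.

Set Implicit Arguments.
Unset Strict Implicit.
Unset Printing Implicit Defensive.

Import GRing.Theory Num.Theory.
Local Open Scope ring_scope.

(* Variables are indexed from 0: the exponent m_j of t_j, for 1 <= j <= k, is
   m i with i = j - 1 : 'I_k. *)
Definition hyperCatalan (k : nat) (m : 'X_{1..k}) : rat :=
  (\sum_(i < k) i.+2 * m i)`!%:R /
  ((1 + \sum_(i < k) i.+1 * m i)`! * \prod_(i < k) (m i)`!)%:R.

(* The bound in 'X_{1..k < n.+1} only makes the index type finite. *)
Definition catalanPoly (n k : nat) : {mpoly rat[k]} :=
  \sum_(m : 'X_{1..k < n.+1} | mdeg m == n) hyperCatalan m *: 'X_[m].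

Definition sumX (k : nat) : {mpoly rat[k]} := \sum_(i < k) 'X_i.

Section Divisibility.

Variable k : nat.
Implicit Types (p : {mpoly rat[k]}) (m : 'X_{1..k}).

Let S := sumX k.

Lemma mderiv_sumX i : S^`M(i) = 1.
Proof.
rewrite /S /sumX linear_sum /= (bigD1 i) //= big1 => [|j ji].
  by rewrite mderivX mnm1E eqxx -mpolyX0 scale1r addr0; congr mpolyX; apply/mnmP => j; rewrite mnmBE subnn mnm0E.
by rewrite mderivX mnm1E (negPf ji) scale0r.
Qed.

Lemma mderiv_sumXn i n : (S ^+ n.+1)^`M(i) = n.+1%:R *: S ^+ n.
Proof.
elim: n => [|n IH]; first by rewrite expr1 mderiv_sumX expr0 scale1r.
rewrite exprS mderivM IH mderiv_sumX mul1r -scalerAr -exprS.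
by rewrite -{1}[S ^+ n.+1]scale1r -scalerDl nat1r.
Qed.

Lemma mcoeff_sumXn n m :
  (S ^+ n)@_m = if mdeg m == n then n`!%:R / (\prod_(i < k) (m i)`!)%:R else 0.
Proof.
elim: n m => [|n IH] m.
  rewrite expr0 mcoeff1 mdeg_eq0; case: eqP => // ->.
  by rewrite big1 ?divr1 // => i _; rewrite mnm0E.
have [->|/eqP] := eqVneq m 0%MM.
  rewrite mdeg0 /= exprS rmorphM /= raddf_sum /= big1 ?mul0r // => i _.
  by rewrite mcoeffX; case: eqP => // /(congr1 (@mdeg k)); rewrite mdeg1 mdeg0.
move=> m0; have [i mi] : exists i, m i != 0%N.
  apply/existsP; apply: contra_notT m0 => /existsPn h.
  by apply/mnmP => i; rewrite mnm0E; apply/eqP; rewrite -[_ == _]negbK.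
have Um : (U_(i) <= m)%MM.
  by apply/mnm_lepP => j; rewrite mnm1E; case: eqP => // <-; rewrite lt0n.
move: (submK Um) mi; set m' := (m - U_(i))%MM => <- _.
have := mcoeff_deriv i m' (S ^+ n.+1).
rewrite mderiv_sumXn mcoeffZ IH mdegD mdeg1 addn1 eqSS.
have -> : (\prod_(j < k) ((m' + U_(i))%MM j)`! =
           (m' i).+1 * \prod_(j < k) (m' j)`!)%N.
  rewrite (bigD1 i) //= [in RHS](bigD1 i) //= mulnA mnmDE mnm1E eqxx addn1.
  rewrite factS; congr (_ * _)%N; apply: eq_bigr => j ji.
  by rewrite mnmDE mnm1E eq_sym (negPf ji) addn0.
have c0 : (m' i).+1%:R != 0 :> rat by rewrite pnatr_eq0.
have d0 : (\prod_(j < k) (m' j)`!)%:R != 0 :> rat.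
  by rewrite pnatr_eq0 -lt0n prodn_gt0 // => j; rewrite fact_gt0.
case: ifP => _ /esym; rewrite -[LHS]mulr_natr => h; apply: (mulIf c0); rewrite h.
  by rewrite factS !natrM; field; rewrite d0 nat1r c0.
by rewrite mulr0 mul0r.
Qed.

(* Each monomial 'X_[m] is an eigenvector of the derivation D = wEuler, for the
   eigenvalue weight m. Hence n.+1`! times catalanPoly n.+1 k is the image of
   S ^+ n.+1 under D (D - 1) ... (D - n + 1), and each of these n factors lowers
   the exponent of the dividing power of S by at most one. *)
Definition weight m := (\sum_(i < k) i.+2 * m i)%N.
Definition wEuler p : {mpoly rat[k]} :=
  \sum_(i < k) i.+2%:R *: ('X_i * p^`M(i)).

Fact wEuler_is_linear : linear wEuler.
Proof.
move=> c p q; rewrite /wEuler scaler_sumr -big_split /=; apply: eq_bigr => i _.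
by rewrite linearP /= mulrDr scalerDr -scalerAr !scalerA [_ * c]mulrC.
Qed.

HB.instance Definition _ :=
  GRing.isLinear.Build rat {mpoly rat[k]} {mpoly rat[k]} _ wEuler
    wEuler_is_linear.

Lemma wEuler_monomial m : wEuler 'X_[m] = (weight m)%:R *: 'X_[m].
Proof.
rewrite /wEuler /weight natr_sum scaler_suml; apply: eq_bigr => i _.
rewrite mderivX -scalerAr scalerA -natrM.
have [->|mi] := eqVneq (m i) 0%N; first by rewrite muln0 !scale0r.
rewrite -mpolyXD addmC submK //; apply/mnm_lepP => j.
by rewrite mnm1E; case: eqP => // <-; rewrite lt0n.
Qed.

Lemma mcoeff_wEuler p m : (wEuler p)@_m = (weight m)%:R * p@_m.
Proof.
have -> : wEuler p = \sum_(m' <- msupp p) (p@_m' * (weight m')%:R) *: 'X_[m'].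
  rewrite {1}[p]mpolyE (linear_sum wEuler); apply: eq_bigr => m' _.
  by rewrite linearZ /= wEuler_monomial scalerA.
rewrite [in RHS](mpolyE p) !(raddf_sum (mcoeff m)) mulr_sumr /=.
apply: eq_bigr => m' _; rewrite !mcoeffZ mcoeffX.
by case: eqP => [->|_]; rewrite ?mulr0 // !mulr1 mulrC.
Qed.

Lemma wEuler_mulSn n p : wEuler (S ^+ n.+1 * p) =
  S ^+ n * (n.+1%:R *: (wEuler S * p) + S * wEuler p).
Proof.
have DS : wEuler S = \sum_(i < k) i.+2%:R *: 'X_i.
  by apply: eq_bigr => i _; rewrite mderiv_sumX mulr1.
rewrite DS; have := mderiv_sumXn^~ n; clearbody S => dS.
rewrite /wEuler mulrDr !(mulr_suml, mulr_sumr) scaler_sumr mulr_sumr.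
rewrite -big_split; apply: eq_bigr => i _ /=; rewrite mderivM dS.
by rewrite -!mul_mpolyC exprS; ring.
Qed.

Fixpoint wEulern n p :=
  if n is n'.+1 then wEuler (wEulern n' p) - n'%:R *: wEulern n' p else p.

Lemma mcoeff_wEulern n p m : (wEulern n p)@_m = ((weight m) ^_ n)%:R * p@_m.
Proof.
elim: n => [|n IH] /=; first by rewrite mul1r.
rewrite mcoeffB mcoeffZ mcoeff_wEuler IH ffactnSr.
have [nw|wn] := leqP n (weight m); first by rewrite natrM natrB //; ring.
by rewrite ffact_small // !(mul0n, mul0r, mulr0) subr0.
Qed.

Lemma wEulern_sumX n j : exists q, wEulern n (S ^+ (n + j)) = S ^+ j * q.
Proof.
elim: n j => [|n IH] j /=; first by exists 1; rewrite mulr1.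
have [q] := IH j.+1; rewrite addnS addSn => ->.
exists (j.+1%:R *: (wEuler S * q) + S * wEuler q - n%:R *: (S * q)).
by rewrite wEuler_mulSn exprSr -mulrA mulrBr -scalerAr.
Qed.

Lemma mcoeff_catalanPoly n m :
  (catalanPoly n k)@_m = if mdeg m == n then hyperCatalan m else 0.
Proof.
rewrite /catalanPoly raddf_sum /=; case: ifPn => [/eqP mn|mn].
  have lt_mn : (mdeg m < n.+1)%N by rewrite mn.
  rewrite (bigD1 (BMultinom lt_mn)) /= ?mn // mcoeffZ mcoeffX eqxx mulr1.
  rewrite big1 ?addr0 // => m' /andP[_ ne]; rewrite mcoeffZ mcoeffX.
  case: eqP => [e|]; last by rewrite mulr0.
  by case/eqP: ne; apply: val_inj.
rewrite big1 // => m' mn'; rewrite mcoeffZ mcoeffX.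
by case: eqP => [e|]; rewrite ?mulr0 //; rewrite -e mn' in mn.
Qed.

Lemma catalanPoly_wEulern n :
  catalanPoly n.+1 k = (n.+1)`!%:R^-1 *: wEulern n (S ^+ n.+1).
Proof.
apply/mpolyP => m; rewrite mcoeff_catalanPoly mcoeffZ mcoeff_wEulern mcoeff_sumXn.
case: eqP => [mn|_]; last by rewrite !mulr0.
rewrite /hyperCatalan -/(weight m).
have wE : (weight m = mdeg m + \sum_(i < k) i.+1 * m i)%N.
  by rewrite mdegE -big_split /=; apply: eq_bigr => i _; rewrite -mulSn.
have -> : (1 + \sum_(i < k) i.+1 * m i = weight m - n)%N by rewrite wE mn; lia.
have nw : (n <= weight m)%N by rewrite wE mn; lia.
rewrite -(ffact_fact nw) !natrM; field.
rewrite nat1r !pnatr_eq0 -!lt0n !fact_gt0 /= ?andbT.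
by rewrite prodn_gt0 // => j; rewrite fact_gt0.
Qed.

Lemma sumX_dvd_catalanPoly n :
  exists q : {mpoly rat[k]}, catalanPoly n.+1 k == sumX k * q.
Proof.
have [q] := wEulern_sumX n 1; rewrite addn1 expr1 => e.
by exists ((n.+1)`!%:R^-1 *: q); rewrite catalanPoly_wEulern e scalerAr.
Qed.

End Divisibility.

Definition geodePoly (n k : nat) : {mpoly rat[k]} :=
  xchoose (sumX_dvd_catalanPoly k n).

Lemma geodePolyE n k : catalanPoly n.+1 k = sumX k * geodePoly n k.
Proof. exact/eqP/(xchooseP (sumX_dvd_catalanPoly k n)). Qed.

Lemma geodePoly_unique n k (q : {mpoly rat[k]}) : (0 < k)%N ->
  catalanPoly n.+1 k = sumX k * q -> q = geodePoly n k.
Proof.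
move=> k0; rewrite geodePolyE => /esym; apply: mulfI.
apply/eqP => /(congr1 (mderiv (Ordinal k0))).
by rewrite mderiv_sumX linear0 => /eqP; rewrite oner_eq0.
Qed.

Definition geode (k : nat) (m : 'X_{1..k}) : rat := (geodePoly (mdeg m) k)@_m.

Definition geode3 (m1 m2 m3 : nat) : rat := geode [multinom [tuple m1; m2; m3]].

(* Main.v *)
(* Write G for [geode3] and C for [hyperCatalan]. Comparing coefficients in
   P = (t_1 + t_2 + t_3) Q gives
     G(a,b,c) + G(a+1,b-1,c) + G(a+1,b,c-1) = C(a+1,b,c).
   By induction on b + c this splits into two-term relations: G(a,b,c) and
   G(a+1,b-1,c) are related by a linear equation whose right-hand side is a
   rational multiple of C(a+1,b,c), and so are G(a,b,c) and G(a+1,b,c-1);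
   a further induction relates G(a,b,c) and G(a+1,b,c) in the same way.
   Following these relations from (n-1,n-1,n-1) to (n,n,n) yields
     G(n,n,n) = r(n) G(n-1,n-1,n-1) + s(n) C(n,n,n)
   with r, s rational. As s(n) C(n,n,n) is hypergeometric, with term ratio
   rho(n), this gives the recurrence with f1(n) = r(n) + rho(n) and
   f2(n) = - rho(n) r(n-1). Both fractions are in lowest terms because they are
   so modulo a suitable prime. *)

From Stdlib Require Import BinInt.
Require Import Defs.
From mathcomp Require Import all_boot all_order all_algebra.
From mathcomp Require Import ring lra zify ssrZ.
From mathcomp.multinomials Require Import mpoly.
Import GRing.Theory Num.Theory.
Local Open Scope ring_scope.
Delimit Scope Z_scope with BZ.

(** * Linear combinations of equations and side conditions of [field] *)

Ltac pos_neq0 :=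
  do ?[apply/andP; split];
  match goal with
  | H : ?P |- ?P => exact H
  | |- _ => apply: lt0r_neq0; lra
  end.

(** Derives a goal c = d from a linear combination a = b of known relations, built with [eq_addr]
    and [eq_mull]; [field] checks the residual identity. *)
Lemma eq_lincomb (R : zmodType) (a b c d : R) :
  a = b -> c - d = a - b -> c = d.
Proof. by move=> ->; rewrite subrr => /eqP; rewrite subr_eq0 => /eqP. Qed.

Lemma eq_addr (R : zmodType) (a b c d : R) : a = b -> c = d -> a + c = b + d.
Proof. by move=> -> ->. Qed.

Lemma eq_mull (R : pzRingType) (p a b : R) : a = b -> p * a = p * b.
Proof. by move=> ->. Qed.

Arguments eq_lincomb {R a b c d}.
Arguments eq_addr {R a b c d}.
Arguments eq_mull {R} p {a b}.

(** * Hyper-Catalan numbers for k = 3 and their term ratios *)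

Definition catalan3 (a b c : nat) : rat :=
  hyperCatalan [multinom [tuple a; b; c]].

Lemma catalan3E a b c :
  catalan3 a b c = (2 * a + 3 * b + 4 * c)`!%:R /
    ((1 + a + 2 * b + 3 * c)`! * (a`! * b`! * c`!))%:R.
Proof.
rewrite /catalan3 /hyperCatalan !big_ord_recr !big_ord0 /=.
by rewrite !multinomE !(tnth_nth 0%N) /= !add0n !mul1n !addnA.
Qed.

Lemma catalan3_000 : catalan3 0 0 0 = 1.
Proof. by rewrite catalan3E. Qed.

Lemma natr_fact_neq0 n : n`!%:R != 0 :> rat.
Proof. by rewrite pnatr_eq0 -lt0n fact_gt0. Qed.

Lemma catalan3_S1 a b c (x : rat := a%:R) (y : rat := b%:R) (z : rat := c%:R) :
  catalan3 a.+1 b c =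
    (2 * x + 3 * y + 4 * z + 2) * (2 * x + 3 * y + 4 * z + 1) /
    ((x + 2 * y + 3 * z + 2) * (x + 1)) * catalan3 a b c.
Proof.
rewrite !catalan3E.
rewrite (_ : 2 * a.+1 + 3 * b + 4 * c = (2 * a + 3 * b + 4 * c).+2)%N; last lia.
rewrite (_ : 1 + a.+1 + 2 * b + 3 * c = (1 + a + 2 * b + 3 * c).+1)%N; last lia.
rewrite !factS !natrM -!natr1 ?(natrD, natrM) -/x -/y -/z.
have [x0 y0 z0] : [/\ 0 <= x, 0 <= y & 0 <= z] by rewrite !ler0n.
clearbody x y z; field; rewrite !natr_fact_neq0 /=; pos_neq0.
Qed.

Lemma catalan3_S2 a b c (x : rat := a%:R) (y : rat := b%:R) (z : rat := c%:R) :
  catalan3 a b.+1 c =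
    (2 * x + 3 * y + 4 * z + 3) * (2 * x + 3 * y + 4 * z + 2) *
    (2 * x + 3 * y + 4 * z + 1) /
    ((x + 2 * y + 3 * z + 3) * (x + 2 * y + 3 * z + 2) * (y + 1)) *
    catalan3 a b c.
Proof.
rewrite !catalan3E.
rewrite (_ : 2 * a + 3 * b.+1 + 4 * c = (2 * a + 3 * b + 4 * c).+3)%N; last lia.
rewrite (_ : 1 + a + 2 * b.+1 + 3 * c = (1 + a + 2 * b + 3 * c).+2)%N; last lia.
rewrite !factS !natrM -!natr1 ?(natrD, natrM) -/x -/y -/z.
have [x0 y0 z0] : [/\ 0 <= x, 0 <= y & 0 <= z] by rewrite !ler0n.
clearbody x y z; field; rewrite !natr_fact_neq0 /=; pos_neq0.
Qed.

Lemma catalan3_S3 a b c (x : rat := a%:R) (y : rat := b%:R) (z : rat := c%:R) :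
  catalan3 a b c.+1 =
    (2 * x + 3 * y + 4 * z + 4) * (2 * x + 3 * y + 4 * z + 3) *
    (2 * x + 3 * y + 4 * z + 2) * (2 * x + 3 * y + 4 * z + 1) /
    ((x + 2 * y + 3 * z + 4) * (x + 2 * y + 3 * z + 3) *
     (x + 2 * y + 3 * z + 2) * (z + 1)) * catalan3 a b c.
Proof.
rewrite !catalan3E.
rewrite (_ : 2 * a + 3 * b + 4 * c.+1 = (2 * a + 3 * b + 4 * c).+4)%N; last lia.
rewrite (_ : 1 + a + 2 * b + 3 * c.+1 = (1 + a + 2 * b + 3 * c).+3)%N; last lia.
rewrite !factS !natrM -!natr1 ?(natrD, natrM) -/x -/y -/z.
have [x0 y0 z0] : [/\ 0 <= x, 0 <= y & 0 <= z] by rewrite !ler0n.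
clearbody x y z; field; rewrite !natr_fact_neq0 /=; pos_neq0.
Qed.

(** * Coefficient comparison in P = (t_1 + t_2 + t_3) Q *)

Lemma mcoeff_Xmul n (i : 'I_n) (q : {mpoly rat[n]}) (m : 'X_{1..n}) :
  ('X_i * q)@_m = if (0 < m i)%N then q@_(m - U_(i)) else 0.
Proof.
rewrite mulrC; case: ifPn => [mi|].
  have Um : (U_(i) <= m)%MM.
    by apply/mnm_lepP => j; rewrite mnm1E; case: eqP => // <-.
  by rewrite -{1}(submK Um) addmC mcoeffMX.
rewrite -eqn0Ngt => /eqP mi; apply/eqP; rewrite mcoeff_eq0.
apply/negP => /msuppM_le /allpairsP[[p1 p2] /=]; rewrite msuppX mem_seq1.
case=> _ /eqP -> mE; move: mi; rewrite mE mnmDE mnm1E eqxx; lia.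
Qed.

(* G(a+1,b-1,c) and G(a+1,b,c-1), read as 0 when an index is negative. *)
Definition geode_pred2 (a b c : nat) : rat :=
  if b is b'.+1 then geode3 a.+1 b' c else 0.

Definition geode_pred3 (a b c : nat) : rat :=
  if c is c'.+1 then geode3 a.+1 b c' else 0.

(** This is the coefficient of t_1^(a+1) t_2^b t_3^c; as a + 1 > 0, the first term is always
    present. *)
Lemma geode3_sum a b c :
  geode3 a b c + geode_pred2 a b c + geode_pred3 a b c = catalan3 a.+1 b c.
Proof.
set m : 'X_{1..3} := [multinom [tuple a.+1; b; c]].
have mE (i : 'I_3) : m i = nth 0%N [:: a.+1; b; c] i.
  by rewrite multinomE (tnth_nth 0%N).
have dE x y z : mdeg [multinom [tuple x; y; z]] = (x + y + z)%N.
  by rewrite mdegE !big_ord_recr big_ord0 /= !multinomE !(tnth_nth 0%N).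
have subE (i : 'I_3) (x y z : nat) :
    [:: x; y; z] =
      [seq nth 0 [:: a.+1; b; c] j - (i == j :> nat) | j <- [:: 0; 1; 2]]%N ->
    (m - U_(i))%MM = [multinom [tuple x; y; z]].
  move=> e; apply/mnmP => j; rewrite mnmBE mE mnm1E multinomE (tnth_nth 0%N) /= e.
  by case: j => -[|[|[|//]]] h.
have := congr1 (mcoeff m) (geodePolyE (a + b + c) 3).
rewrite mcoeff_catalanPoly dE !addSn eqxx -/(catalan3 _ _ _) => ->.
rewrite /sumX mulr_suml raddf_sum !big_ord_recr big_ord0 /= add0r.
rewrite !mcoeff_Xmul !mE /=.
congr (_ + _ + _).
- by rewrite /geode3 /geode dE (subE _ a b c) //= subn1 !subn0.
- case: b @m mE subE => [//|b] m mE subE /=.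
  rewrite (subE _ a.+1 b c) /= ?subn1 ?subn0 // /geode3 /geode dE.
  by rewrite addSn addnS.
- case: c @m mE subE => [//|c] m mE subE /=.
  rewrite (subE _ a.+1 b c) /= ?subn1 ?subn0 // /geode3 /geode dE.
  by rewrite !addSn addnS.
Qed.

(** * Two-term relations between neighbouring Geode numbers *)

(** Induction on b + c. For b > 0, [geode3_sum] at (a,b,c) and (a+1,b-1,c) is combined with the
    induction hypothesis at (a+1,b-1,c) and, if c > 0, at (a+1,b,c-1). *)
Lemma geode_pred2E a b c (x : rat := a%:R) (y : rat := b%:R) (z : rat := c%:R) :
  (2 * x + 3 * y + 3 * z + 3) * geode_pred2 a b c + y * geode3 a b c =
  y * (2 * x + 3 * y + 4 * z + 3) / (x + y + z + 1) * catalan3 a.+1 b c.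
Proof.
rewrite /x /y /z {x y z}; have [n] := ubnP (b + c).
elim: n a b c => // n IH a [|b] c lt_n; first by rewrite !(mulr0, mul0r, addr0).
rewrite [geode_pred2 _ _ _]/=.
have T0 : geode3 a b.+1 c =
    catalan3 a.+1 b.+1 c - geode3 a.+1 b c - geode_pred3 a b.+1 c.
  by rewrite -geode3_sum /=; ring.
have T1 : geode_pred2 a.+1 b c =
    catalan3 a.+2 b c - geode3 a.+1 b c - geode_pred3 a.+1 b c.
  by rewrite -geode3_sum; ring.
have lt_bc : (b + c < n)%N by lia.
have E1 := IH a.+1 b c lt_bc; rewrite {}T1 in E1; rewrite {}T0.
have [x0 y0 z0] : [/\ 0 <= a%:R :> rat, 0 <= b%:R :> rat & 0 <= c%:R :> rat].
  by rewrite !ler0n.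
case: c {lt_bc} z0 lt_n E1 => [|c] z0 lt_n E1.
  rewrite /= in E1 *; clear IH lt_n.
  move: E1; rewrite catalan3_S1 (catalan3_S2 a.+1) -!natr1.
  move: (geode3 _ _ _) (catalan3 _ _ _) => g h.
  move: (a%:R : rat) (b%:R : rat) x0 y0 => x y x0 y0 {z0} E1.
  by apply: (eq_lincomb (eq_mull (-1) E1)); field; pos_neq0.
have lt_bc : (b.+1 + c < n)%N by lia.
have E2 := IH a.+1 b.+1 c lt_bc; rewrite /= in E1 E2 *; clear IH lt_n lt_bc.
have {z0} z0 : 0 <= c%:R :> rat by rewrite ler0n.
move: E1 E2; rewrite (catalan3_S1 a.+1 b c.+1) (catalan3_S1 a.+1 b.+1).
rewrite (catalan3_S3 a.+1 b.+1) (catalan3_S3 a.+1 b) (catalan3_S2 a.+1) -!natr1.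
move: (geode3 _ b _) (geode3 _ b.+1 c) (geode3 _ _ _) (catalan3 _ _ _) => g g' g'' h.
move: (a%:R : rat) (b%:R : rat) (c%:R : rat) x0 y0 z0 => x y z x0 y0 z0 E1 E2.
(* The leading factor 2x + 3y + 3z + 3 takes the same value in both uses of the induction
   hypothesis, so G(a+2,b,c) cancels. *)
apply: (eq_lincomb (eq_addr (eq_mull (-1) E1) (eq_mull (-1) E2))).
by field; pos_neq0.
Qed.

Lemma geode_pred3E a b c (x : rat := a%:R) (y : rat := b%:R) (z : rat := c%:R) :
  (2 * x + 3 * y + 3 * z + 3) * geode_pred3 a b c +
  (2 * x + 2 * y + 3 * z + 3) * geode3 a b c =
  (2 * x + 3 * y + 3 * z + 3 -
   y * (2 * x + 3 * y + 4 * z + 3) / (x + y + z + 1)) * catalan3 a.+1 b c.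
Proof. by rewrite mulrBl -geode_pred2E -geode3_sum -/x -/y -/z; ring. Qed.

(* Found by interpolation from values of the two sides of [geode3_S1]. *)
Definition geode_step (n v k : rat) : rat :=
  2 * v * (2 * n - 1) * k ^+ 2 - 2 * n * v * (3 * n + v) * (3 * n + v - 1) +
  k * (27 * n ^+ 3 + 30 * n ^+ 2 * v + 7 * n * v ^+ 2 + n * v - 3 * n -
       v ^+ 2 - 3 * v).

(** Induction on b + c. The neighbour relations move both ends of the step to (a+1,b-1,c), or to
    (a+1,0,c-1) if b = 0, where the induction hypothesis applies. For b = c = 0 the Geode numbers
    are themselves hyper-Catalan numbers. *)
Lemma geode3_S1 a b c (x : rat := a%:R) (y : rat := b%:R) (z : rat := c%:R)
    (n : rat := x + y + z + 2) (v : rat := x + 2 * y + 3 * z + 3)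
    (k : rat := 2 * x + 2 * y + 3 * z + 4)
    (m : rat := 2 * x + 3 * y + 3 * z + 3) :
  (3 * n + 1) * (3 * n) * (3 * n - 1) * (k + 1) * k * geode3 a.+1 b c +
  2 * n * (2 * n - 1) * (n - 1) * (m + 2) * (m + 1) * geode3 a b c =
  (n + v - 1) * (n + v - 2) * geode_step n v k / v * catalan3 a.+1 b c.
Proof.
rewrite /m /k /v /n /z /y /x {n v k m x y z}; have [n] := ubnP (b + c).
elim: n a b c => // n IH a b c lt_n.
have [x0 y0 z0] : [/\ 0 <= a%:R :> rat, 0 <= b%:R :> rat & 0 <= c%:R :> rat].
  by rewrite !ler0n.
case: b y0 lt_n => [|b] y0 lt_n; last first.
  have {y0} y0 : 0 <= b%:R :> rat by rewrite ler0n.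
  have lt_bc : (b + c < n)%N by lia.
  have := IH a.+1 b c lt_bc; have := geode_pred2E a b.+1 c.
  have := geode_pred2E a.+1 b.+1 c; rewrite /= {IH lt_n lt_bc}.
  rewrite !(catalan3_S1 a.+1) (catalan3_S2 a.+1) -(natr1 a) -(natr1 b).
  move: (geode3 a.+2 b c) (geode3 a.+1 b c) (geode3 a.+1 b.+1 c) (geode3 _ _ _).
  move: (catalan3 _ _ _) => h p1 p0 g1 g0.
  move: (a%:R : rat) (b%:R : rat) (c%:R : rat) x0 y0 z0 => x y z x0 y0 z0.
  set n' := (X in 3 * X + 1); set k := (X in _ * (X + 1) * X * _).
  pose m := 2 * x + 3 * y + 3 * z + 6 => A' A I.
  (* From (a,b+1,c) to (a+1,b,c), n' and k are unchanged and m drops by 1, so one multiple of [I]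
     cancels both G(a+2,b,c) and G(a+1,b,c). *)
  apply: (eq_lincomb (eq_addr
    (eq_mull
      ((3 * n' + 1) * (3 * n') * (3 * n' - 1) * (k + 1) * k / (y + 1)) A')
    (eq_addr
      (eq_mull
        (2 * n' * (2 * n' - 1) * (n' - 1) * (m + 2) * (m + 1) / (y + 1)) A)
      (eq_mull (- (m + 2) / (y + 1)) I)))).
  rewrite /geode_step /n' /k /m {n' k m A' A I}.
  by field; pos_neq0.
case: c z0 lt_n => [|c] z0 lt_n; last first.
  have {z0} z0 : 0 <= c%:R :> rat by rewrite ler0n.
  have lt_bc : (0 + c < n)%N by lia.
  have := IH a.+1 0 c lt_bc; have := geode_pred3E a 0 c.+1.
  have := geode_pred3E a.+1 0 c.+1; rewrite /= {IH lt_n lt_bc}.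
  rewrite !(catalan3_S1 a.+1) (catalan3_S3 a.+1) -(natr1 a) -(natr1 c).
  move: (geode3 a.+2 0 c) (geode3 a.+1 0 c) (geode3 a.+1 0 c.+1) (geode3 _ _ _).
  move: (catalan3 _ _ _) => h p1 p0 g1 g0.
  move: (a%:R : rat) (c%:R : rat) x0 z0 => x z x0 z0.
  pose n' := x + z + 3; pose k := 2 * x + 3 * z + 7.
  pose m := 2 * x + 3 * z + 6 => A' A I.
  (* Now k also drops by 1; k + 1 and k - 1 are the coefficients of G(a+1,0,c+1) in [A'] and of
     G(a,0,c+1) in [A]. *)
  apply: (eq_lincomb (eq_addr
    (eq_mull ((3 * n' + 1) * (3 * n') * (3 * n' - 1) * k) A')
    (eq_addr
      (eq_mull
        (2 * n' * (2 * n' - 1) * (n' - 1) * (m + 2) * (m + 1) / (k - 1)) A)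
      (eq_mull (- (m + 2) / (k - 1)) I)))).
  rewrite /geode_step /n' /k /m {n' k m A' A I}.
  by field; pos_neq0.
have G0 i : geode3 i 0 0 = catalan3 i.+1 0 0 by rewrite -geode3_sum /= !addr0.
rewrite !G0 (catalan3_S1 a.+1) -(natr1 a) /geode_step.
move: (a%:R : rat) (catalan3 _ _ _) x0 => x h x0.
by field; pos_neq0.
Qed.

(** * Coprimality by reduction modulo a prime *)

(** Both morphisms keep the leading coefficients nonzero, hence commute with the resultant. Its
    image under [f] is nonzero, so it is nonzero in R, and so is its image under the injective
    [g]. *)
Lemma coprimep_of_morph (R : comNzRingType) (F K : fieldType)
    (f : {rmorphism R -> F}) (g : {rmorphism R -> K}) (p q : {poly R}) :
  injective g -> f (lead_coef p) != 0 -> f (lead_coef q) != 0 ->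
  coprimep (map_poly f p) (map_poly f q) ->
  coprimep (map_poly g p) (map_poly g q).
Proof.
(* [map_resultant] is only available for morphisms out of {poly R}, whence the
   detour through constant polynomials. *)
move=> g_inj fp fq cop_f.
have evalC (h : {poly R}) : map_poly (horner_eval 0) h^:P = h.
  rewrite -map_poly_comp map_poly_id // => c _ /=.
  by rewrite /horner_eval hornerC.
have lcC (h : {poly R}) : lead_coef h^:P = (lead_coef h)%:P.
  exact: lead_coef_map_inj (@polyC_inj R) (polyC0 R) _.
have resE (L : nzRingType) (h : {rmorphism R -> L}) :
    h (lead_coef p) != 0 -> h (lead_coef q) != 0 ->
    h (resultant p^:P q^:P).[0] = resultant (map_poly h p) (map_poly h q).
  move=> hp hq; have := @map_resultant R L (h \o horner_eval 0) p^:P q^:P.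
  by rewrite /= !map_poly_comp !evalC => -> //; rewrite lcC /horner_eval hornerC.
have g_neq0 (h : R) : f h != 0 -> g h != 0.
  apply: contra => /eqP gh; rewrite (_ : h = 0) ?rmorph0 //.
  by apply: g_inj; rewrite gh rmorph0.
have : resultant (map_poly f p) (map_poly f q) != 0.
  by rewrite resultant_eq0 -leqNgt; move: cop_f; rewrite /coprimep => /eqP ->.
rewrite -resE // => /g_neq0; rewrite resE ?g_neq0 // resultant_eq0 -leqNgt.
rewrite /coprimep leq_eqVlt ltnS leqn0 => /orP[//|].
rewrite size_poly_eq0 gcdp_eq0.
rewrite map_poly_eq0_id0 ?g_neq0 // => /andP[/eqP p0 _].
by move: fp; rewrite p0 lead_coef0 rmorph0 eqxx.
Qed.

(** * Computable integer polynomials *)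

Local Notation Z := BinNums.Z.

(* Integer polynomials as lists of binary coefficients, constant term first, so
   that sizes and Bezout identities can be checked by evaluation. *)
Fixpoint addL (s t : seq Z) : seq Z :=
  match s, t with
  | [::], _ => t
  | _, [::] => s
  | a :: s', b :: t' => BinInt.Z.add a b :: addL s' t'
  end.

Fixpoint mulL (s t : seq Z) : seq Z :=
  if s is a :: s' then addL (map (BinInt.Z.mul a) t) (0 :: mulL s' t) else [::].

(* The product is taken in this order because [mulL t [::]] consists of zeros,
   which would spoil the leading coefficient. *)
Definition shiftL (s : seq Z) : seq Z :=
  foldr (fun c r => addL [:: c] (mulL r [:: -1; 1])) [::] s.

Definition linL (c : Z) (s : seq (Z * Z)) : seq Z :=
  foldr (fun u r => mulL [:: u.2; u.1] r) [:: c] s.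

Lemma Poly_addL s t : Poly (addL s t) = Poly s + Poly t.
Proof.
elim: s t => [|a s IH] [|b t] /=; rewrite ?(add0r, addr0) //.
by rewrite !cons_poly_def IH mulrDl polyCD addrACA.
Qed.

Lemma Poly_mulL s t : Poly (mulL s t) = Poly s * Poly t.
Proof.
elim: s => [|a s IH] /=; first by rewrite mul0r.
rewrite Poly_addL /= !cons_poly_def IH polyC0 addr0 mulrDl mulrAC addrC.
congr (_ + _); rewrite mul_polyC; apply/polyP => i; rewrite coefZ !coef_Poly.
have [lt_i|le_i] := ltnP i (size t); first by rewrite (nth_map 0).
by rewrite !nth_default ?mulr0 // size_map.
Qed.

Arguments addL : simpl never.
Arguments mulL : simpl never.

Definition ratZ : {rmorphism Z -> rat} := intr \o int_of_Z.

Lemma ratZ_inj : injective ratZ.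
Proof. exact: inj_comp (@intr_inj _) (can_inj int_of_ZK). Qed.

Definition polyL (s : seq Z) : {poly rat} := map_poly ratZ (Poly s).

Definition evalL (s : seq Z) (x : rat) : rat := (polyL s).[x].

Lemma evalL_nil x : evalL [::] x = 0.
Proof. by rewrite /evalL /polyL /= rmorph0 horner0. Qed.

Lemma evalL_cons c s x : evalL (c :: s) x = ratZ c + x * evalL s x.
Proof.
rewrite /evalL /polyL /= cons_poly_def rmorphD rmorphM /= map_polyX map_polyC.
by rewrite !hornerE mulrC addrC.
Qed.

Lemma evalL_add s t x : evalL (addL s t) x = evalL s x + evalL t x.
Proof. by rewrite /evalL /polyL Poly_addL rmorphD hornerD. Qed.

Lemma evalL_mul s t x : evalL (mulL s t) x = evalL s x * evalL t x.
Proof. by rewrite /evalL /polyL Poly_mulL rmorphM hornerM. Qed.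

Lemma evalL_shift s x : evalL (shiftL s) x = evalL s (x - 1).
Proof.
elim: s => [|c s IH] /=; first by rewrite !evalL_nil.
rewrite evalL_add evalL_mul !evalL_cons !evalL_nil IH rmorphN !rmorph1; ring.
Qed.

Lemma evalL_lin c s x :
  evalL (linL c s) x = \prod_(u <- s) (ratZ u.1 * x + ratZ u.2) * ratZ c.
Proof.
elim: s => [|u s IH] /=.
  by rewrite big_nil evalL_cons evalL_nil mulr0 addr0 mul1r.
by rewrite big_cons evalL_mul !evalL_cons evalL_nil IH; ring.
Qed.

Lemma size_polyL s : last 0 s != 0 -> size (polyL s) = size s.
Proof.
by move=> s0; rewrite size_map_inj_poly ?(PolyK s0) //; exact: ratZ_inj.
Qed.

Definition dvdL (l : nat) (s : seq Z) : bool :=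
  all (fun c => BinInt.Z.eqb (BinInt.Z.modulo c (BinInt.Z.of_nat l)) 0) s.

(** Lets the computable test [dvdL] certify vanishing in characteristic l. *)
Lemma rmorph_modZ (F : fieldType) (l : nat) (f : {rmorphism Z -> F}) c :
  l \in [pchar F] ->
  f c = f (BinInt.Z.modulo c (BinInt.Z.of_nat l)).
Proof.
move=> lF; have l0 : f (BinInt.Z.of_nat l) = 0.
  have -> : BinInt.Z.of_nat l = l%:R :> Z.
    by elim: (l) => // n IH; rewrite -natr1 -IH /GRing.add /=; lia.
  by rewrite rmorph_nat pcharf0.
have lZ : BinInt.Z.of_nat l <> BinNums.Z0.
  by have := prime_gt0 (pcharf_prime lF); lia.
rewrite {1}(BinInt.Z.div_mod c _ lZ).
rewrite (rmorphD f (BinInt.Z.mul _ _)) (rmorphM f (BinInt.Z.of_nat l)).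
by rewrite l0 mul0r add0r.
Qed.

(* [w1] and [w2] witness that the leading coefficients are invertible modulo
   [l], and [u], [v] are Bezout coefficients modulo [l]. *)
Lemma coprimep_polyL (l : nat) (s t u v : seq Z) (w1 w2 : Z) :
  prime l -> last 0 s != 0 -> last 0 t != 0 ->
  dvdL l [:: last 0 s * w1 - 1; last 0 t * w2 - 1] ->
  dvdL l (addL (addL (mulL u s) (mulL v t)) [:: -1]) ->
  coprimep (polyL s) (polyL t).
Proof.
move=> l_pr s0 t0 wl bez; pose f : {rmorphism Z -> 'F_l} := intr \o int_of_Z.
have dvdf r c : dvdL l r -> c \in r -> f c = 0.
  move=> /allP h /h /BinInt.Z.eqb_eq e.
  by rewrite (rmorph_modZ _ _ _ _ (pchar_Fp l_pr)) e rmorph0.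
have lastE r : last 0 r != 0 -> lead_coef (Poly r) = last 0 r.
  by move=> r0; rewrite lead_coefE (PolyK r0) nth_last.
have unit_f r w : f (last 0 r * w - 1) = 0 -> f (last 0 r) != 0.
  move=> /eqP; rewrite rmorphB rmorph1 rmorphM subr_eq0 => /eqP e.
  by apply/eqP => z; move/eqP: e; rewrite z mul0r eq_sym oner_eq0.
apply: (coprimep_of_morph _ _ _ f ratZ _ _ ratZ_inj); rewrite ?lastE //.
- by apply: (unit_f _ w1); apply: dvdf wl _; rewrite inE eqxx.
- by apply: (unit_f _ w2); apply: dvdf wl _; rewrite !inE eqxx orbT.
(* A common divisor divides u s + v t, which is 1 modulo l by [bez]. *)
apply/coprimepP => d ds dt; rewrite -size_poly_eq1 -dvdp1.
have : map_poly f (Poly (addL (addL (mulL u s) (mulL v t)) [:: -1])) = 0.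
  apply/polyP => i; rewrite coef_map coef_Poly coef0 /=.
  have [lt_i|le_i] := ltnP i (size (addL (addL (mulL u s) (mulL v t)) [:: -1])).
    by apply: dvdf bez _; apply: mem_nth.
  by rewrite nth_default // rmorph0.
have PolyN1 : Poly [:: -1] = -1 :> {poly Z}.
  by rewrite /= cons_poly_def mul0r add0r polyCN.
rewrite !Poly_addL !Poly_mulL PolyN1 !rmorphD !rmorphM rmorphN1 => /eqP.
by rewrite subr_eq0 => /eqP <-; rewrite dvdp_add ?dvdp_mull.
Qed.

(** * The first-order inhomogeneous recurrence on the diagonal *)

(* The nontrivial factor of the numerator of s. *)
Definition diagS : seq Z :=
  [:: -6967296; 30237696; 1847738112; -8163145792; -187324485728;
   850945416592; 9158274876448; -43710493103060; -225435832155482;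
   1184068027925765; 2607550423562559; -16933283295507591;
   -8569132706262609; 117786477838138047; -59615520795972819;
   -301839421005801657; 330529343477746815]%BZ.

Definition pm7 (x : rat) : rat :=
  (7 * x - 3) * (7 * x - 2) * (7 * x - 1) *
  (7 * x + 1) * (7 * x + 2) * (7 * x + 3).

Definition m9 (x : rat) : rat := (9 * x - 4) * (9 * x - 2) * (9 * x - 1).

Definition p9 (x : rat) : rat := (9 * x + 1) * (9 * x + 2) * (9 * x + 4).

Definition diag_r (x : rat) : rat :=
  - 1024 / 21 * ((2 * x - 1) ^+ 2 * (3 * x - 2) * (3 * x - 1) *
    (4 * x - 1) * (4 * x + 1) * (6 * x - 1) * (6 * x + 1) *
    (8 * x - 3) * (8 * x - 1) * (8 * x + 1) * (8 * x + 3)) /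
  (pm7 x * m9 x * p9 x).

Definition diag_s (x : rat) : rat :=
  evalL diagS x / (378 * (3 * x + 1) * pm7 x * m9 x ^+ 2 * p9 x).

(** The path is (n,n,n), (n+1,n,n), (n+2,n,n), (n+3,n,n) by [geode3_S1], then (n+2,n+1,n) by
    [geode_pred2E] and (n+1,n+1,n+1) by [geode_pred3E]. *)
Lemma geode3_diag n (x : rat := n.+1%:R) :
  geode3 n.+1 n.+1 n.+1 =
  diag_r x * geode3 n n n + diag_s x * catalan3 n.+1 n.+1 n.+1.
Proof.
rewrite {}/x.
have := geode_pred3E n.+1 n.+1 n.+1; have := geode_pred2E n.+2 n.+1 n.
have := geode3_S1 n.+2 n n; have := geode3_S1 n.+1 n n; have := geode3_S1 n n n.
rewrite !(catalan3_S1 n.+2) !(catalan3_S3 _ n.+1) !(catalan3_S2 _ n).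
rewrite !(catalan3_S1 n.+1) /= -(natr1 n.+1) -(natr1 n).
have : 0 <= n%:R :> rat by rewrite ler0n.
move: (n%:R : rat) => x.
move: (geode3 n.+3 n n) (geode3 n.+2 n n) (geode3 n.+1 n n) (geode3 n n n).
move: (geode3 n.+2 n.+1 n) (geode3 n.+1 n.+1 n.+1) (catalan3 _ _ _).
move=> g4 g5 h g3 g2 g1 g0 x0 E0 E1 E2 E3 E4.
(* [al i] and [be i] are the left-hand coefficients of [geode3_S1] at (n+i,n,n). [c4] normalizes the
   coefficient of G(n+1,n+1,n+1) to 1; each of [c3] to [c0] cancels the next intermediate Geode
   number. *)
pose al (i : rat) := let n := 3 * x + i + 2 in let k := 7 * x + 2 * i + 4 in
  (3 * n + 1) * (3 * n) * (3 * n - 1) * (k + 1) * k.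
pose be (i : rat) := let n := 3 * x + i + 2 in let m := 8 * x + 2 * i + 3 in
  2 * n * (2 * n - 1) * (n - 1) * (m + 2) * (m + 1).
pose c4 := (7 * x + 10)^-1; pose c3 := - c4 * (8 * x + 11) / (x + 1).
pose c2 := - c3 * (8 * x + 10) / al 2; pose c1 := - c2 * be 2 / al 1.
pose c0 := - c1 * be 1 / al 0.
apply: (eq_lincomb (eq_addr (eq_mull c0 E0) (eq_addr (eq_mull c1 E1)
  (eq_addr (eq_mull c2 E2) (eq_addr (eq_mull c3 E3) (eq_mull c4 E4)))))).
rewrite /diag_r /diag_s /pm7 /m9 /p9 /c0 /c1 /c2 /c3 /c4 /al /be /geode_step.
rewrite {c0 c1 c2 c3 c4 al be E0 E1 E2 E3 E4} /diagS !evalL_cons evalL_nil.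
rewrite /ratZ.
by field; pos_neq0.
Qed.

(** * The coefficients of the recurrence, in lowest terms *)

(** Write L, A, B, C for [recL], [recA], [recB], [recC] and S for [diagS]. Then r = A / L, rho(x) =
    B(x) S(x) / (L(x) S(x-1)) and - rho(x) r(x-1) = C(x) S(x) / (L(x) S(x-1)). *)
Definition recL : seq Z := linL 168
  [:: (1, 0); (1, 0); (1, 0); (2, -1); (3, 1); (6, -1); (6, 1); (7, -3);
   (7, -2); (7, -1); (7, 1); (7, 2); (7, 3); (9, -4); (9, -2); (9, -1);
   (9, 1); (9, 2); (9, 4)]%BZ.

Definition recA : seq Z := linL (-8192)
  [:: (1, 0); (1, 0); (1, 0); (2, -1); (2, -1); (2, -1); (3, -2); (3, -1);
   (3, 1); (4, -1); (4, 1); (6, -1); (6, -1); (6, 1); (6, 1); (8, -3);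
   (8, -1); (8, 1); (8, 3)]%BZ.

Definition recB : seq Z := linL 189
  [:: (3, -2); (7, -10); (7, -9); (7, -8); (7, -6); (7, -5); (7, -4); (9, -13);
   (9, -13); (9, -11); (9, -11); (9, -10); (9, -10); (9, -8); (9, -8);
   (9, -7); (9, -7); (9, -5); (9, -5)]%BZ.

Definition recC : seq Z := linL 9216
  [:: (2, -3); (2, -3); (3, -5); (3, -4); (3, -2); (4, -5); (4, -3); (6, -7);
   (6, -5); (8, -11); (8, -9); (8, -7); (8, -5); (9, -13); (9, -11);
   (9, -10); (9, -8); (9, -7); (9, -5)]%BZ.

Definition rec_den : seq Z := mulL recL (shiftL diagS).

Definition rec_num1 : seq Z :=
  addL (mulL recA (shiftL diagS)) (mulL recB diagS).

Definition rec_num2 : seq Z := mulL recC diagS.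

(** The prime 83 divides neither the leading coefficients nor the resultant; 103 does the same for
    the second fraction. *)
Lemma coprimep_rec1 : coprimep (polyL rec_num1) (polyL rec_den).
Proof.
apply: (coprimep_polyL 83 _ _
  [:: 33; 54; 21; 40; 32; 69; 59; 78; 55; 20; 65; 14; 69; 12; 13; 11; 43; 46;
   51; 53; 16; 52; 56; 28; 55; 81; 18; 55; 49; 24; 8; 58; 42; 56; 2]%BZ
  [:: 37; 73; 60; 16; 78; 42; 30; 30; 41; 16; 67; 23; 65; 9; 21; 60; 3; 14; 33;
   16; 56; 73; 17; 36; 82; 68; 56; 45; 21; 56; 51; 0; 42; 42; 10]%BZ
  31%BZ 11%BZ) => //; by vm_compute.
Qed.

Lemma coprimep_rec2 : coprimep (polyL rec_num2) (polyL rec_den).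
Proof.
apply: (coprimep_polyL 103 _ _
  [:: 19; 24; 75; 69; 18; 56; 10; 43; 53; 47; 101; 81; 83; 100; 82; 65; 8; 32;
   36; 88; 47; 30; 69; 98; 72; 24; 43; 10; 28; 2; 6; 45; 33; 62; 10]%BZ
  [:: 13; 37; 86; 25; 4; 40; 30; 14; 20; 44; 54; 31; 9; 85; 96; 58; 36; 25; 57;
   83; 96; 1; 89; 61; 73; 71; 16; 59; 66; 92; 4; 60; 9; 66; 57]%BZ
  39%BZ 97%BZ) => //; by vm_compute.
Qed.

(** * The recurrence and its initial values *)

Lemma catalan3_diag n (x : rat := n%:R) :
  catalan3 n.+1 n.+1 n.+1 =
  (9 * x + 9) * (9 * x + 8) * (9 * x + 7) * (9 * x + 6) * (9 * x + 5) *
  (9 * x + 4) * (9 * x + 3) * (9 * x + 2) * (9 * x + 1) /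
  ((6 * x + 7) * (6 * x + 6) * (6 * x + 5) * (6 * x + 4) * (6 * x + 3) *
   (6 * x + 2) * (x + 1) ^+ 3) * catalan3 n n n.
Proof.
rewrite catalan3_S3 catalan3_S2 catalan3_S1 -(natr1 n) -/x.
have : 0 <= x by rewrite ler0n.
by clearbody x => x0; field; pos_neq0.
Qed.

(** Explicit linear factors let [pos_neq0] treat denominators factor by factor. *)
Definition recL_at (x : rat) : rat :=
  168 * (x ^+ 3 * (2 * x - 1) * (3 * x + 1) * (6 * x - 1) * (6 * x + 1) *
   (7 * x - 3) * (7 * x - 2) * (7 * x - 1) * (7 * x + 1) * (7 * x + 2) *
   (7 * x + 3) * (9 * x - 4) * (9 * x - 2) * (9 * x - 1) * (9 * x + 1) *
   (9 * x + 2) * (9 * x + 4)).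

Lemma evalL_recL x : evalL recL x = recL_at x.
Proof.
by rewrite /recL_at /recL evalL_lin !big_cons big_nil /fst /snd /ratZ; ring.
Qed.

Definition recA_at (x : rat) : rat :=
  - 8192 * (x ^+ 3 * (2 * x - 1) ^+ 3 * (3 * x - 2) * (3 * x - 1) *
   (3 * x + 1) * (4 * x - 1) * (4 * x + 1) * (6 * x - 1) ^+ 2 * (6 * x + 1) ^+ 2 *
   (8 * x - 3) * (8 * x - 1) * (8 * x + 1) * (8 * x + 3)).

Lemma evalL_recA x : evalL recA x = recA_at x.
Proof.
by rewrite /recA_at /recA evalL_lin !big_cons big_nil /fst /snd /ratZ; ring.
Qed.

Definition recB_at (x : rat) : rat :=
  189 * ((3 * x - 2) * (7 * x - 10) * (7 * x - 9) * (7 * x - 8) * (7 * x - 6) *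
   (7 * x - 5) * (7 * x - 4) * (9 * x - 13) ^+ 2 * (9 * x - 11) ^+ 2 *
   (9 * x - 10) ^+ 2 * (9 * x - 8) ^+ 2 * (9 * x - 7) ^+ 2 *
   (9 * x - 5) ^+ 2).

Lemma evalL_recB x : evalL recB x = recB_at x.
Proof.
by rewrite /recB_at /recB evalL_lin !big_cons big_nil /fst /snd /ratZ; ring.
Qed.

Definition recC_at (x : rat) : rat :=
  9216 * ((2 * x - 3) ^+ 2 * (3 * x - 5) * (3 * x - 4) * (3 * x - 2) *
   (4 * x - 5) * (4 * x - 3) * (6 * x - 7) * (6 * x - 5) * (8 * x - 11) *
   (8 * x - 9) * (8 * x - 7) * (8 * x - 5) * (9 * x - 13) * (9 * x - 11) *
   (9 * x - 10) * (9 * x - 8) * (9 * x - 7) * (9 * x - 5)).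

Lemma evalL_recC x : evalL recC x = recC_at x.
Proof.
by rewrite /recC_at /recC evalL_lin !big_cons big_nil /fst /snd /ratZ; ring.
Qed.

Lemma evalL_rec_den x :
  evalL rec_den x = recL_at x * evalL diagS (x - 1).
Proof. by rewrite -evalL_recL -evalL_shift -evalL_mul. Qed.

Lemma evalL_rec_num1 x : evalL rec_num1 x =
  recA_at x * evalL diagS (x - 1) + recB_at x * evalL diagS x.
Proof.
by rewrite -evalL_recA -evalL_recB -evalL_shift -!evalL_mul -evalL_add.
Qed.

Lemma evalL_rec_num2 x : evalL rec_num2 x = recC_at x * evalL diagS x.
Proof. by rewrite -evalL_recC -evalL_mul. Qed.

(* The values [q], [p1], [p2] are kept abstract: comparing them as evaluations
   of explicit polynomials would make unification expand the latter. *)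
Lemma geode3_rec n (q p1 p2 : rat) (x : rat := n.+2%:R) :
  q = recL_at x * evalL diagS (x - 1) ->
  p1 = recA_at x * evalL diagS (x - 1) + recB_at x * evalL diagS x ->
  p2 = recC_at x * evalL diagS x -> q != 0 ->
  geode3 n.+2 n.+2 n.+2 =
  p1 / q * geode3 n.+1 n.+1 n.+1 + p2 / q * geode3 n n n.
Proof.
move=> -> -> ->; rewrite mulf_eq0 => /norP[_ S0].
have := geode3_diag n.+1; have := geode3_diag n.
rewrite (catalan3_diag n.+1) /diag_s -/x.
have -> : n.+1%:R = x - 1 :> rat by rewrite /x -(natr1 n.+1) addrK.
(* This bound makes every linear factor in a denominator positive, including shifted ones such as 7
   (x - 1) - 3; [S0] covers S(x-1). *)
have x2 : 2 <= x by rewrite /x ler_nat.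
move: (geode3 n n n) (geode3 n.+1 n.+1 n.+1) (geode3 n.+2 n.+2 n.+2).
move: (catalan3 _ _ _) (evalL diagS (x - 1)) (evalL diagS x) S0.
move=> h S1 S2 S0 g0 g1 g2 D1 D2.
pose c := - (recB_at x * S2) / (recL_at x * S1).
apply: (eq_lincomb (eq_addr D2 (eq_mull c D1))).
rewrite {}/c {D1 D2}; clearbody x.
rewrite /recL_at /recA_at /recB_at /recC_at /diag_r /pm7 /m9 /p9.
by field; pos_neq0.
Qed.

Lemma geode3_000 : geode3 0 0 0 = 1.
Proof.
have := geode3_sum 0 0 0; rewrite /= !addr0 => ->.
by rewrite catalan3_S1 catalan3_000.
Qed.

Lemma geode3_111 : geode3 1 1 1 = 319.
Proof.
rewrite geode3_diag geode3_000 catalan3_diag catalan3_000 /diag_s.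
rewrite /diag_r /pm7 /m9 /p9 /diagS !evalL_cons evalL_nil /ratZ.
by field.
Qed.

(** The value 669123 is split to keep the numerals small. *)
Lemma geode3_222 : geode3 2 2 2 = 669 * 1000 + 123.
Proof.
rewrite geode3_diag geode3_111 !catalan3_diag catalan3_000 /diag_s.
rewrite /diag_r /pm7 /m9 /p9 /diagS !evalL_cons evalL_nil /ratZ.
by field.
Qed.

Theorem theorem3 :
  (exists p1 q1 p2 q2 : {poly rat},
     [/\ size p1 = 36%N, size q1 = 36%N & coprimep p1 q1] /\
     [/\ size p2 = 36%N, size q2 = 36%N & coprimep p2 q2] /\
     forall n : nat, (3 <= n)%N -> q1.[n%:R] != 0 -> q2.[n%:R] != 0 ->
       geode3 n n n =
         p1.[n%:R] / q1.[n%:R] * geode3 (n - 1) (n - 1) (n - 1)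
         + p2.[n%:R] / q2.[n%:R] * geode3 (n - 2) (n - 2) (n - 2)) /\
  geode3 1 1 1 = 319 /\ geode3 2 2 2 = 669 * 1000 + 123.
Proof.
(* Degree 35 is 19 from L plus 16 from S; both fractions share this denominator. *)
have den_size : size (polyL rec_den) = 36%N.
  by rewrite size_polyL //; vm_compute.
split; last by split; [exact: geode3_111 | exact: geode3_222].
exists (polyL rec_num1), (polyL rec_den), (polyL rec_num2), (polyL rec_den).
split; first by split=> //; [rewrite size_polyL //; vm_compute |
                             exact: coprimep_rec1].
split; first by split=> //; [rewrite size_polyL //; vm_compute |
                             exact: coprimep_rec2].
move=> [|[|n]] // _ q0 _; rewrite subn1 subn2 /=.
exact: geode3_rec (evalL_rec_den _) (evalL_rec_num1 _) (evalL_rec_num2 _) q0.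
Qed.
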